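(* Let $(\mathcal P_n)_{n\in\mathbb N}$ be a sequence where each $\mathcal P_n=(C_1,\dots,C_{m_n})$ is an ordered partition of $\{0,1\}^n$, and assume $\max_{i\in[m_n]}|C_i|\in\mathcal O(n)$. Then $|\mathrm{Orbit}_n(\mathcal P_n)|$ grows asymptotically faster than any polynomial in $2^n=|\{0,1\}^n|$.
   Context: $[n]=\{1,\dots,n\}$ and $\mathrm{Sym}_n$ is the symmetric group on $[n]$. $\mathrm{Sym}_n$ acts on $\{0,1\}^n$ by permuting positions: for $v=v_1\cdots v_n$, $\pi(v)=v_{\pi^{-1}(1)}v_{\pi^{-1}(2)}\cdots v_{\pi^{-1}(n)}$; this extends elementwise to sets of strings and componentwise to tuples of such sets. An ordered partition $(C_1,\dots,C_m)$ of $\{0,1\}^n$ is a tuple of pairwise disjoint nonempty sets with union $\{0,1\}^n$ (the colour classes). $\mathrm{Orbit}_n(\mathcal P)=\{\pi(\mathcal P):\pi\in\mathrm{Sym}_n\}$. *)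

(* Defs.v *)
From mathcomp Require Import all_boot all_fingroup.

Set Implicit Arguments.
Unset Strict Implicit.
Unset Printing Implicit Defensive.

Section BitStrings.
Variable n : nat.

(* Strings are indexed by 'I_n = {0, ..., n-1} instead of {1, ..., n}. *)
Definition bitstring : finType := n.-tuple bool.

Definition perm_string (pi : 'S_n) (v : bitstring) : bitstring :=
  [tuple tnth v ((pi^-1)%g i) | i < n].

Definition perm_strings (pi : 'S_n) (C : {set bitstring}) : {set bitstring} :=
  [set perm_string pi v | v in C].

Definition perm_classes m (pi : 'S_n) (P : m.-tuple {set bitstring}) :
    m.-tuple {set bitstring} :=
  [tuple perm_strings pi (tnth P i) | i < m].

Definition ordered_partition m (P : m.-tuple {set bitstring}) : Prop :=
  [/\ forall i j : 'I_m, i != j -> [disjoint tnth P i & tnth P j],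
      forall i : 'I_m, tnth P i != set0
    & \bigcup_(i < m) tnth P i = [set: bitstring]].

Definition max_class_size m (P : m.-tuple {set bitstring}) : nat :=
  \max_(i < m) #|tnth P i|.

Definition Orbit m (P : m.-tuple {set bitstring}) :
    {set m.-tuple {set bitstring}} :=
  [set perm_classes pi P | pi : 'S_n].

End BitStrings.

(* Main.v *)
Require Import Defs.
From mathcomp Require Import all_boot all_order all_algebra all_fingroup.
From mathcomp Require Import all_classical all_reals all_analysis.
From mathcomp Require Import zify.
Import Order.TTheory GRing.Theory Num.Theory.
Import numFieldNormedType.Exports.

(** Let k = ceil(log2 n). The k strings listing the j-th binary digits of the
positions (j < k) separate the positions, so a permutation s is determined by
the images of these k strings. Once s(P) is known, the image of a string of
class C_i is confined to the i-th class of s(P), which has at most M = max |C_i|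
elements; hence n! <= |Orbit(P)| * M^k. As M = O(n), M^k = 2^O(log(n)^2) is
negligible against n! = 2^Omega(n log n), and so is 2^(nd) for every d. *)

Set Implicit Arguments.
Unset Strict Implicit.
Unset Printing Implicit Defensive.

Lemma eq_binary_digits (k a b : nat) :
  a < 2 ^ k -> b < 2 ^ k ->
  (forall j, j < k -> odd (a %/ 2 ^ j) = odd (b %/ 2 ^ j)) -> a = b.
Proof.
elim: k a b => [|k IHk] a b.
  by rewrite expn0 !ltnS !leqn0 => /eqP-> /eqP->.
rewrite expnS => alt blt eq_dig.
have /(congr1 double) : a %/ 2 = b %/ 2.
  apply: IHk; rewrite ?ltn_divLR // 1?mulnC // => j jk.
  by rewrite -!divnMA -expnS eq_dig.
have := eq_dig 0 isT; rewrite expn0 !divn1 !divn2 => eq_odd eq_half.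
by rewrite -[a]odd_double_half -[b]odd_double_half eq_odd eq_half.
Qed.

Definition digit_string (n j : nat) : bitstring n :=
  [tuple odd (i %/ 2 ^ j) | i < n].

(** Entry [i] of the permuted [digit_string n j] is the [j]-th digit of the preimage of [i], so the
    [k] entries at [i] recover that preimage. *)
Lemma perm_digit_strings_inj (n k : nat) (s t : 'S_n) :
  n <= 2 ^ k ->
  (forall j, j < k ->
     perm_string s (digit_string n j) = perm_string t (digit_string n j)) ->
  s = t.
Proof.
move=> n_le eq_st; apply: invg_inj; apply/permP => i; apply/val_inj.
apply: (@eq_binary_digits k); rewrite ?(leq_trans (ltn_ord _)) // => j jk.
have := congr1 (fun v => tnth v i) (eq_st j jk).
by rewrite !tnth_mktuple.
Qed.

Lemma card_class_le (n m : nat) (P : m.-tuple {set bitstring n}) (s : 'S_n)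
    (i : 'I_m) :
  #|tnth (perm_classes s P) i| <= max_class_size P.
Proof.
rewrite tnth_mktuple (leq_trans (leq_imset_card _ _)) //.
exact: (leq_bigmax (F := fun i => #|tnth P i|)).
Qed.

Lemma card_family_const_le (I T : finType) (F : I -> {set T}) (M : nat) :
  (forall i, #|F i| <= M) -> #|family F| <= M ^ #|I|.
Proof.
move=> leM; rewrite card_family foldrE big_image /=.
rewrite -prod_nat_const; exact: leq_prod.
Qed.

(** The images of the [k] digit strings embed this coset into a product of [k] classes of
    [perm_classes t P], which does not depend on [s]. *)
Lemma card_stabilizer_coset_le (n m k : nat) (P : m.-tuple {set bitstring n})
    (t : 'S_n) :
  ordered_partition P -> n <= 2 ^ k ->
  #|[set s : 'S_n | perm_classes s P == perm_classes t P]| <=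
    max_class_size P ^ k.
Proof.
move=> [_ _ coverP] n_le.
have cls (j : 'I_k) : {i : 'I_m | digit_string n j \in tnth P i}.
  apply: sigW; have := finset.in_setT (digit_string n j).
  by rewrite -coverP => /finset.bigcupP[i _]; exists i.
pose f (s : 'S_n) := [ffun j : 'I_k => perm_string s (digit_string n j)].
pose F (j : 'I_k) := tnth (perm_classes t P) (sval (cls j)).
have f_inj : injective f.
  move=> s s' /ffunP eq_f; apply: (perm_digit_strings_inj n_le) => j jk.
  by have := eq_f (Ordinal jk); rewrite !ffunE.
rewrite -(card_imset _ f_inj) -[X in _ ^ X]card_ord.
apply: leq_trans (card_family_const_le (F := F) _); last first.
  by move=> j; apply: card_class_le.
apply/subset_leq_card/fintype.subsetP => _ /imsetP[s + ->].
rewrite inE => /eqP eqP; apply/familyP => j; rewrite ffunE /F -eqP tnth_mktuple.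
by apply: imset_f; apply: (svalP (cls j)).
Qed.

(** The symmetric group splits into the fibres of [fun s => perm_classes s P], one for each point of
    the orbit. *)
Lemma fact_le_card_Orbit (n m k : nat) (P : m.-tuple {set bitstring n}) :
  ordered_partition P -> n <= 2 ^ k ->
  n`! <= #|Orbit P| * max_class_size P ^ k.
Proof.
move=> hP n_le; rewrite -card_Sn.
rewrite -[leqLHS]sum1_card (partition_big_imset (fun s => perm_classes s P)) /=.
rewrite -sum_nat_const; apply: leq_sum => _ /imsetP[t _ ->].
apply: leq_trans (card_stabilizer_coset_le t hP n_le).
by rewrite -sum1_card; under [X in _ <= X]eq_bigl do rewrite inE.
Qed.

(** The factors [b + 1, ..., n] of the factorial all exceed [b]; for [n <= b] the truncated exponent
    is 0. *)
Lemma expn_le_fact (b n : nat) : b ^ (n - b) <= n`!.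
Proof.
elim: n => [|n IHn] //; case: (leqP n.+1 b) => [le_nb | lt_bn].
  by rewrite (eqP le_nb) fact_gt0.
by rewrite subSn // expnS factS leq_mul // ltnW.
Qed.

Lemma expn_le_fact_of_sqr (b n : nat) : 0 < b -> 2 * b ^ 2 <= n -> b ^ n <= n`!.
Proof.
(* Squaring the base pays for the lost factors: [2 * (n - b ^ 2) >= n]. *)
move=> b_gt0 le_n; apply: leq_trans (expn_le_fact (b ^ 2) n).
by rewrite -expnM leq_pexp2l //; lia.
Qed.

(** Equality holds at [k = 7]. The shift [k.+1] fits [k = up_log 2 n - 1], since [n] is only known
    to exceed that power of 2. *)
Lemma double_sqr_le_expn2 (k : nat) : 7 <= k -> 2 * k.+1 ^ 2 <= 2 ^ k.
Proof.
elim: k => [//|k IHk]; rewrite leq_eqVlt => /orP[/eqP <- //|].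
rewrite ltnS => lek; rewrite [leqRHS]expnS.
by apply: leq_trans (leq_mul (leqnn 2) (IHk lek)); nia.
Qed.

Lemma superpolynomial_fact (N C d : nat) :
  exists n0, forall n, n0 <= n ->
    N * 2 ^ (n * d) * (C * n) ^ up_log 2 n <= n`!.
Proof.
(* The summands give [N <= n], [C <= n], [k >= 8], and the threshold for comparing the factorial
   with powers of [2 ^ d.+2]; the extra 2 in [d.+2] absorbs one factor [2 ^ n] for [N] and one for
   [(C * n) ^ k]. *)
exists (N + C + 2 ^ 8 + 2 * (2 ^ d.+2) ^ 2) => n le_n.
have n1 : 1 < n by lia.
set k := up_log 2 n.
have n_le : n <= 2 ^ k by apply: up_logP.
have lt_n : 2 ^ k.-1 < n by apply: up_log_gtn.
have k8 : 8 <= k by rewrite -(@leq_exp2l 2) //; lia.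
have le_k : 2 * k ^ 2 <= n.
  have := @double_sqr_le_expn2 k.-1; rewrite prednK; lia.
have leN : N <= 2 ^ n by apply: leq_trans (ltnW (ltn_expl n _)) => //; lia.
(* [C * n <= n ^ 2 <= 2 ^ (2 * k)], and [2 * k ^ 2 <= n]. *)
have leC : (C * n) ^ k <= 2 ^ n.
  apply: leq_trans (_ : (2 ^ (2 * k)) ^ k <= _).
    rewrite leq_exp2r; last lia.
    by rewrite mul2n -addnn expnD leq_mul //; lia.
  by rewrite -expnM leq_exp2l //; lia.
have le_fact : (2 ^ d.+2) ^ n <= n`!.
  by apply: expn_le_fact_of_sqr; [rewrite expn_gt0 | lia].
apply: leq_trans le_fact.
apply: leq_trans (leq_mul (leq_mul leN (leqnn _)) leC) _.
by rewrite -!expnD -expnM leq_exp2l //; lia.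
Qed.

Local Open Scope classical_set_scope.
Local Open Scope ring_scope.

Lemma horner_norm_le (R : realDomainType) (p : {poly R}) (x : R) :
  1 <= x -> `|p.[x]| <= (\sum_(i < size p) `|p`_i|) * x ^+ size p.
Proof.
move=> x1; rewrite horner_coef mulr_suml (le_trans (ler_norm_sum _ _ _)) //.
apply: ler_sum => i _; rewrite normrM ler_wpM2l //.
rewrite ger0_norm ?exprn_ge0 ?(le_trans ler01) //.
by rewrite ler_weXn2l // ltnW.
Qed.

Lemma card_Orbit_superpolynomial (m : nat -> nat)
    (P : forall n : nat, (m n).-tuple {set bitstring n}) (N C d : nat) :
  (forall n, ordered_partition (P n)) ->
  (\forall n \near \oo, max_class_size (P n) <= C * n)%N ->
  (\forall n \near \oo, N * 2 ^ (n * d) <= #|Orbit (P n)|)%N.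
Proof.
(* [C.+1] instead of [C] keeps the factor to be cancelled positive even when [C = 0]. *)
move=> hP leM; have [n0 fact_ge] := superpolynomial_fact N C.+1 d.
near=> n.
have n_gt0 : (0 < n)%N by near: n; exact: nbhs_infty_ge.
have le_n : (n0 <= n)%N by near: n; exact: nbhs_infty_ge.
have le_max : (max_class_size (P n) <= C * n)%N by near: n.
have Cn_gt0 : (0 < (C.+1 * n) ^ up_log 2 n)%N by rewrite expn_gt0 muln_gt0 n_gt0.
rewrite -(leq_pmul2r Cn_gt0) (leq_trans (fact_ge n le_n)) //.
apply: leq_trans (fact_le_card_Orbit (hP n) (up_logP n (ltnSn 1))) _.
rewrite leq_mul //.
case: (posnP (up_log 2 n)) => [->|k0]; first by rewrite !expn0.
by rewrite leq_exp2r // (leq_trans le_max) // leq_mul2r leqnSn orbT.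
Unshelve. all: end_near. Qed.

Theorem theorem13 (R : realType) (m : nat -> nat)
    (P : forall n : nat, (m n).-tuple {set bitstring n})
    (hP : forall n : nat, ordered_partition (P n))
    (hO : (fun n : nat => (max_class_size (P n))%:R : R^o) =O_\oo
          (fun n : nat => n%:R : R^o)) :
  forall p : {poly R},
    (fun n : nat => p.[2 ^+ n] : R^o) =o_\oo
    (fun n : nat => #|Orbit (P n)|%:R : R^o).
Proof.
move=> p; move/eqO_exP: hO => [/= c c0 hc].
apply/eqoP => /= e e0.
pose A : R := \sum_(i < size p) `|p`_i|.
(* With this [N], [A * 2 ^ (n * size p) <= e * N * 2 ^ (n * size p)], so the arbitrary [e] of the
   little-o is absorbed into the integer factor [N]. *)
pose N := Num.bound (A / e); pose C := Num.bound c.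
have A0 : 0 <= A by apply: sumr_ge0.
have leN : A <= e * N%:R.
  rewrite mulrC -ler_pdivrMr // ltW //.
  by apply: archi_boundP; rewrite divr_ge0 // ltW.
have leM : (\forall n \near \oo, max_class_size (P n) <= C * n)%N.
  near=> n; have : `|(max_class_size (P n))%:R : R^o| <= c * `|n%:R : R^o|.
    by near: n.
  rewrite !ger0_norm // => le_cn; rewrite -(ler_nat R) natrM (le_trans le_cn) //.
  by rewrite ler_wpM2r // ltW // archi_boundP // ltW.
have := card_Orbit_superpolynomial N (size p) hP leM.
apply: filterS => n leO.
have x1 : 1 <= 2 ^+ n :> R by rewrite exprn_ege1 // ler1n.
apply: le_trans (horner_norm_le p x1) _.
rewrite [leRHS](_ : _ = e * (#|Orbit (P n)|)%:R); last by rewrite ger0_norm.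
apply: le_trans (_ : e * (N * 2 ^ (n * size p))%N%:R <= _); last first.
  by rewrite ler_pM2l // ler_nat.
by rewrite natrM natrX exprM mulrA ler_wpM2r // exprn_ge0 // (le_trans ler01).
Unshelve. all: end_near. Qed.
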